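(* The set $\mathscr{D}$ of max-plus polynomials on the barcode space, with addition $\boxplus$ (pointwise maximum) and multiplication $\odot$ (pointwise sum), is a filtered semiring. It is generated by the elements $\sigma_{(0,1)^n}$, $n$ a positive integer, in the sense that every element of $\mathscr{D}$ is a max-plus polynomial, with real coefficients, in finitely many of the elements $\sigma_{(0,1)^n}$.
   Context: Notation: $a\boxplus b=\max(a,b)$, $a\odot b=a+b$; powers are with respect to $\odot$, so $x^k$ means $kx$. A max-plus polynomial in variables $z_1,\dots,z_r$ is a function of the form $\boxplus_{i=1}^m a_i\odot z_1^{c_1^i}\odot\cdots\odot z_r^{c_r^i}$, i.e. $\max_{1\le i\le m}(a_i+c_1^iz_1+\cdots+c_r^iz_r)$, with $m\ge 1$, $a_i\in\mathbb{R}$ and nonnegative integers $c_j^i$; expressions defining the same function are identified. Its (total) degree is $\max_i(c_1^i+\cdots+c_r^i)$. Barcodes: an interval is encoded as $(x,d)$, with left endpoint $x\ge0$ and length $d\ge0$. $B_n$ is the orbit space of $([0,\infty)\times[0,\infty))^n$ under the action of the symmetric group $S_n$ permuting the $n$ pairs. The barcode space is $B=\coprod_nB_n/_\sim$, where $\sim$ is generated by $\{(x_1,d_1),\dots,(x_n,d_n)\}\sim\{(x_1,d_1),\dots,(x_{n-1},d_{n-1})\}$ whenever $d_n=0$. $D_n$ is the semiring of max-plus polynomials $p(x_1,d_1,\dots,x_n,d_n)$, regarded as functions on $([0,\infty)\times[0,\infty))^n$, such that for every $j$ the restriction of $p$ to $\{d_j=0\}$ is independent of $x_j$; these are exactly the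 functions $\boxplus_i a_0^i\odot d_1^{b_1^i}\odot\cdots\odot d_n^{b_n^i}$ with $a_0^i\in\mathbb{R}$ and $b_j^i$ nonnegative integers. $D_n^{S_n}$ is the set of elements of $D_n$ invariant under the action of $S_n$ permuting the pairs $(x_i,d_i)$, and ${}_kD_n^{S_n}$ is the subset of elements of degree at most $k$. For each $n$, let ${}_kD_n^{S_n}\to{}_kD_{n-1}^{S_{n-1}}$ be the map $f\mapsto f(x_1,d_1,\dots,x_{n-1},d_{n-1},0,0)$. $\mathscr{D}^k$ is the inverse limit over $n$ of this system, and $\mathscr{D}=\bigcup_{k\ge1}\mathscr{D}^k$. An element $(f_n)_n$ of $\mathscr{D}$ defines a function on $B$ by applying $f_n$ to barcodes with $n$ intervals; operations are componentwise. $\sigma_{(0,1)^n}\in\mathscr{D}$ is the function giving the total length of the $n$ longest intervals of a barcode: on barcodes with $N\ge n$ intervals it is $\max_{\pi\in S_N}(d_{\pi(1)}+\cdots+d_{\pi(n)})$, and barcodes with fewer than $n$ intervals are first padded with zero-length intervals. A semiring $(\mathscr{R},+,\cdot)$ is filtered if there is a family $\{\mathscr{R}_d\}_{d\in\mathbb{N}}$ of subsets of $\mathscr{R}$, each closed under the operation $+$, with $\mathscr{R}_d\subset\mathscr{R}_{d'}$ for $d\le d'$, $\mathscr{R}=\bigcup_d\mathscr{R}_d$, and $\mathscr{R}_d\cdot\mathscr{R}_{d'}\subset\mathscr{R}_{d+d'}$ for all $d,d'$. *)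

(* Defs.v *)
From HB Require Import structures.
From mathcomp Require Import all_boot all_order all_algebra all_fingroup.
From mathcomp Require Import interval_inference.
From mathcomp Require Import classical_sets reals.

Set Implicit Arguments.
Unset Strict Implicit.
Unset Printing Implicit Defensive.

Import Order.TTheory GRing.Theory Num.Theory.
Local Open Scope classical_set_scope.
Local Open Scope ring_scope.

(* A formal max-plus polynomial with m = mp_size.+1 >= 1 monomials
   a_i (.) \prod_j z_j ^ c_j^i, in variables indexed by the finite type I. *)
Record mp_expr (R : realType) (I : finType) := MPExpr {
  mp_size : nat;
  mp_coef : 'I_mp_size.+1 -> R;
  mp_exp : 'I_mp_size.+1 -> I -> nat
}.

Definition mp_monomial (R : realType) (I : finType) (e : mp_expr R I)
    (z : I -> R) (i : 'I_(mp_size e).+1) : R :=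
  mp_coef i + \sum_(j : I) z j *+ mp_exp i j.
Arguments mp_monomial {R I} e z i.

(* Real numbers have no least element: the maximum is started from one of the
   monomials over which it ranges. *)
Definition mp_eval (R : realType) (I : finType) (e : mp_expr R I)
    (z : I -> R) : R :=
  \big[Num.max/mp_monomial e z ord0]_(i < (mp_size e).+1) mp_monomial e z i.

Definition mp_degree (R : realType) (I : finType) (e : mp_expr R I) : nat :=
  (\max_(i < (mp_size e).+1) \sum_(j : I) mp_exp i j)%N.

(* ([0, oo) * [0, oo))^n: the i-th interval is (left endpoint, length). *)
Definition bars (R : realType) (n : nat) : Type :=
  'I_n -> {nonneg R} * {nonneg R}.

(* The variables x_i are indexed by inl i, the variables d_i by inr i. *)
Definition bar_coord (R : realType) (n : nat) (s : bars R n)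
    (v : 'I_n + 'I_n) : R :=
  match v with
  | inl i => (s i).1%:num
  | inr i => (s i).2%:num
  end.

(* Keeps the first intervals of s, and appends (0, 0) up to length M. *)
Definition bar_pad (R : realType) (N M : nat) (s : bars R N) : bars R M :=
  fun i => oapp s (0%:nng, 0%:nng) (insub (val i)).
Arguments bar_pad {R N} M s i.

Definition represents (R : realType) (n : nat)
    (e : mp_expr R ('I_n + 'I_n)%type) (p : bars R n -> R) : Prop :=
  forall s, p s = mp_eval e (bar_coord s).

Definition mp_polynomial (R : realType) (n : nat) : set (bars R n -> R) :=
  [set p | exists e, represents e p].

(* All the expressions representing a given function have the same degree,
   which can be read off the growth of the function along x_i = d_i = t. *)
Definition degree_le (R : realType) (k n : nat) : set (bars R n -> R) :=
  [set p | exists2 e, represents e p & (mp_degree e <= k)%N].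

Definition Dn (R : realType) (n : nat) : set (bars R n -> R) :=
  [set p | mp_polynomial p /\
    forall (j : 'I_n) (s t : bars R n),
      (s j).2%:num = 0 -> (t j).2%:num = 0 ->
      (forall i, i != j -> s i = t i) ->
      p s = p t].

Definition symmetric_fun (R : realType) (n : nat) : set (bars R n -> R) :=
  [set p | forall (pi : 'S_n) (s : bars R n), p (fun i => s (pi i)) = p s].

Definition kDS (R : realType) (k n : nat) : set (bars R n -> R) :=
  @Dn R n `&` @symmetric_fun R n `&` @degree_le R k n.

Definition bar_family (R : realType) : Type := forall n : nat, bars R n -> R.

(* The inverse limit D^k; the transition maps send f to
   f(x_1, d_1, ..., x_n, d_n, 0, 0). *)
Definition Dlim (R : realType) (k : nat) : set (bar_family R) :=
  [set f : bar_family R | (forall n, kDS k (f n)) /\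
           (forall n (s : bars R n), f n.+1 (bar_pad n.+1 s) = f n s)].

Definition Dbar (R : realType) : set (bar_family R) :=
  \bigcup_(k in [set k | (1 <= k)%N]) @Dlim R k.

Definition boxplus (R : realType) (f g : bar_family R) : bar_family R :=
  fun n s => Num.max (f n s) (g n s).

Definition odot (R : realType) (f g : bar_family R) : bar_family R :=
  fun n s => f n s + g n s.

(* The function sigma_((0,1)^n): s is padded to maxn n N intervals, which changes
   nothing when n <= N. The sum for the identity only seeds the maximum. *)
Definition sigma01 (R : realType) (n : nat) : bar_family R :=
  fun N s =>
    let sum_len (pi : 'S_(maxn n N)) : R :=
      \sum_(i < n) (bar_pad (maxn n N) s (pi (widen_ord (leq_maxl n N) i))).2%:num
    in \big[Num.max/sum_len 1%g]_(pi : 'S_(maxn n N)) sum_len pi.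

(* No neutral element for add is required, so this is weaker than MathComp's
   semirings: max-plus polynomials have at least one monomial, with a real
   coefficient, so the constant -oo is excluded and max has no neutral
   element among them. *)
Record is_semiring (T : Type) (S : set T) (add mul : T -> T -> T) : Prop := {
  semiring_add_closed : forall a b, S a -> S b -> S (add a b);
  semiring_mul_closed : forall a b, S a -> S b -> S (mul a b);
  semiring_addA : forall a b c, S a -> S b -> S c ->
    add a (add b c) = add (add a b) c;
  semiring_addC : forall a b, S a -> S b -> add a b = add b a;
  semiring_mulA : forall a b c, S a -> S b -> S c ->
    mul a (mul b c) = mul (mul a b) c;
  semiring_one : exists2 e, S e & forall a, S a -> mul e a = a /\ mul a e = a;
  semiring_mulDl : forall a b c, S a -> S b -> S c ->
    mul (add a b) c = add (mul a c) (mul b c);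
  semiring_mulDr : forall a b c, S a -> S b -> S c ->
    mul a (add b c) = add (mul a b) (mul a c)
}.

Record is_filtered_semiring (T : Type) (S : set T) (add mul : T -> T -> T)
    (F : nat -> set T) : Prop := {
  filtered_semiring : is_semiring S add mul;
  filtered_add_closed : forall d a b, F d a -> F d b -> F d (add a b);
  filtered_mono : forall d d', (d <= d')%N -> F d `<=` F d';
  filtered_cover : S = \bigcup_d F d;
  filtered_mul : forall d d' a b, F d a -> F d' b -> F (d + d')%N (mul a b)
}.

(* Main.v *)
Require Import Defs.
From mathcomp Require Import all_boot all_order all_algebra all_fingroup.
From mathcomp Require Import interval_inference.
From mathcomp Require Import classical_sets reals boolp.

(** The polynomials in D_n involve only the lengths d_i. On lengths sorted in
    decreasing order, the largest value of a monomial d ^ c under permutations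
    is the sum, over t, of the total length of the #|{i | t < c i}| longest
    intervals. Hence an invariant polynomial of degree at most k is a max-plus
    polynomial in sigma_1, ..., sigma_k; these depend only on the k longest
    intervals, so compatibility with the transition maps lets the expression
    found on k intervals serve for every number of intervals. *)

Set Implicit Arguments.
Unset Strict Implicit.
Unset Printing Implicit Defensive.

Import Order.TTheory GRing.Theory Num.Theory.

Local Open Scope ring_scope.

(** * Initial segments of ordinals and sorting permutations *)

Lemma card_ord_lt (N n : nat) : (n <= N)%N ->
  #|[set i : 'I_N | (i < n)%N]%SET| = n.
Proof.
move=> le_nN; rewrite -sum1_card (eq_bigl (fun i : 'I_N => (i < n)%N)).
  by rewrite big_ord_narrow // sum_nat_const card_ord muln1.
by move=> i; rewrite inE.
Qed.

Lemma card_ord_lt_le (N n : nat) : (#|[set i : 'I_N | (i < n)%N]%SET| <= n)%N.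
Proof.
have [le_nN | /ltnW le_Nn] := leqP n N; first by rewrite card_ord_lt.
by apply: leq_trans (max_card _) _; rewrite card_ord.
Qed.

(** A member [i] brings all [i.+1] indices up to [i] into [D], while a non-member [i] confines [D]
    to the [i] indices below it. *)
Lemma in_initial_segment (N : nat) (D : {set 'I_N}) :
    (forall i j : 'I_N, (i <= j)%N -> j \in D -> i \in D) ->
  forall i, (i \in D) = (i < #|D|)%N.
Proof.
move=> downD i; have [Di | nDi] := boolP (i \in D).
  rewrite -{1}(card_ord_lt (ltn_ord i)); apply/esym/subset_leq_card.
  apply/fintype.subsetP=> j.
  by rewrite inE ltnS => le_ji; apply: downD Di.
apply/esym/negbTE; rewrite -leqNgt.
apply: leq_trans (card_ord_lt_le N i).
apply/subset_leq_card/fintype.subsetP=> j Dj.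
by rewrite inE ltnNge; apply: contra nDi => /downD; apply.
Qed.

(** The target is an arbitrary total order because three kinds of keys occur: lengths, exponents,
    and Boolean membership in a set. *)
Lemma perm_sorting (N : nat) (d : Order.disp_t) (T : orderType d)
    (g : 'I_N -> T) :
  exists pi : 'S_N, forall i j : 'I_N, (i <= j)%N -> (g (pi j) <= g (pi i))%O.
Proof.
pose leg : rel 'I_N := fun i j => (g j <= g i)%O.
pose t := sort leg (enum 'I_N).
have size_t : size t = N by rewrite size_sort size_enum_ord.
have uniq_t : uniq t by rewrite sort_uniq enum_uniq.
have inj_t : injective (fun i : 'I_N => nth i t i).
  move=> i j; rewrite (set_nth_default i) ?size_t // => /eqP.
  by rewrite nth_uniq ?size_t // => /eqP/val_inj.
exists (perm inj_t) => i j le_ij; rewrite !permE (set_nth_default i) ?size_t //.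
have tr_leg : transitive leg by move=> x y z /= yx /le_trans; apply.
have srt : sorted leg t by apply: sort_sorted => x y; apply: le_total.
by apply: (sorted_leq_nth tr_leg _ i srt);
  rewrite ?inE ?size_t // => x; apply: le_refl.
Qed.

(** * Attained maxima and evaluation of max-plus expressions *)

Section Bigmax.
Variables (R : realType) (I : finType) (F : I -> R).

Lemma bigmax_ge (x : R) i : F i <= \big[Num.max/x]_(j : I) F j.
Proof. by rewrite (bigD1 i) //= le_max lexx. Qed.

Lemma bigmax_attained (i0 : I) :
  exists i, \big[Num.max/F i0]_(j : I) F j = F i.
Proof.
elim/big_ind: _ => [|_ _ [i ->] [j ->]|i _]; [by exists i0 | | by exists i].
by case: (leP (F i) (F j)); [exists j | exists i].
Qed.
End Bigmax.

Section Eval.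
Variables (R : realType) (I : finType).
Implicit Types (e : mp_expr R I) (z : I -> R).

Lemma mp_eval_ge e z i : mp_monomial e z i <= mp_eval e z.
Proof. exact: bigmax_ge. Qed.

Lemma mp_eval_attained e z : exists i, mp_eval e z = mp_monomial e z i.
Proof. exact: bigmax_attained. Qed.

Lemma mp_exp_le e k (i : 'I_(mp_size e).+1) :
  (mp_degree e <= k)%N -> (\sum_j mp_exp i j <= k)%N.
Proof. by move=> /bigmax_leqP; apply. Qed.

(** Allows monomials to be indexed by any inhabited finite type, such as sums, products or families
    of sets. The maximum is described as an attained upper bound, which is the form in which it is
    checked later. *)
Lemma mp_exprP (J : finType) (j0 : J) (a : J -> R) (c : J -> I -> nat)
    (k : nat) :
    (forall j, (\sum_i c j i <= k)%N) ->
  exists2 e, (mp_degree e <= k)%N &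
    forall z m, (forall j, a j + \sum_i z i *+ c j i <= m) ->
      (exists j, m = a j + \sum_i z i *+ c j i) -> m = mp_eval e z.
Proof.
move=> c_le.
(* Since [j0] inhabits [J], [#|J|.-1.+1] equals [#|J|]; [j0] is also the default of [nth]. *)
exists (MPExpr (fun i : 'I_#|J|.-1.+1 => a (nth j0 (enum J) i))
               (fun i : 'I_#|J|.-1.+1 => c (nth j0 (enum J) i))).
  by apply/bigmax_leqP=> i _; apply: c_le.
move=> z m; set e := MPExpr _ _ => ub_m [j m_eq].
apply/le_anti/andP; split; last first.
  by have [i ->] := mp_eval_attained e z; apply: ub_m.
have J_gt0 : (0 < #|J|)%N by apply/card_gt0P; exists j.
have lt_j : (index j (enum J) < #|J|.-1.+1)%N.
  by rewrite prednK // cardE index_mem mem_enum.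
apply: le_trans (mp_eval_ge (e := e) z (Ordinal lt_j)).
by rewrite /mp_monomial /= nth_index ?mem_enum // m_eq.
Qed.
End Eval.

(** * Padding and truncation of barcodes *)

Lemma bar_pad_lt (R : realType) (N M : nat) (s : bars R N) (i : 'I_M)
    (lt_iN : (i < N)%N) : bar_pad M s i = s (Ordinal lt_iN).
Proof. by rewrite /bar_pad insubT. Qed.

Lemma bar_pad_ge (R : realType) (N M : nat) (s : bars R N) (i : 'I_M) :
  (N <= i)%N -> bar_pad M s i = (0%:nng, 0%:nng).
Proof. by move=> le_Ni; rewrite /bar_pad insubN // -leqNgt. Qed.

Lemma bar_pad_id (R : realType) (N : nat) (s : bars R N) : bar_pad N s = s.
Proof.
by apply: funext => i; rewrite (bar_pad_lt s (ltn_ord i)); congr s;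
  apply: val_inj.
Qed.

(** The hypothesis says that the intermediate size [N] keeps every interval of [s] that survives in
    size [M]. *)
Lemma bar_pad_pad (R : realType) (k N M : nat) (s : bars R k) :
  (minn k M <= N)%N -> bar_pad M (bar_pad N s) = bar_pad M s.
Proof.
move=> le_N; apply: funext => i; have [lt_ik | le_ki] := ltnP i k.
  have lt_iN : (i < N)%N by apply: leq_trans le_N; rewrite leq_min lt_ik /=.
  by rewrite (bar_pad_lt _ lt_iN) !bar_pad_lt.
rewrite [RHS]bar_pad_ge //; have [lt_iN | le_Ni] := ltnP i N.
  by rewrite (bar_pad_lt _ lt_iN) bar_pad_ge.
by rewrite bar_pad_ge.
Qed.

(** * The functions [sigma01] as maxima over sets of at most n intervals *)

Section Sigma.
Variable R : realType.

Lemma sumr_subset_le (I : finType) (A B : {pred I}) (F : I -> R) :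
    (forall i, 0 <= F i) -> {subset A <= B} ->
  \sum_(i in A) F i <= \sum_(i in B) F i.
Proof.
move=> F_ge0 sAB; rewrite [leRHS](bigID [in A]) /= [X in X + _](eq_bigl [in A]).
  by rewrite lerDl sumr_ge0.
by move=> i; case: (boolP (i \in A)) => [/sAB->|]; rewrite ?andbF.
Qed.

Lemma sum_bar_pad (N M : nat) (s : bars R N) (le_NM : (N <= M)%N)
    (P : pred 'I_M) :
  \sum_(i < M | P i) (bar_pad M s i).2%:num =
  \sum_(i < N | P (widen_ord le_NM i)) (s i).2%:num.
Proof.
rewrite (bigID (fun i : 'I_M => (i < N)%N)) /=.
rewrite [X in _ + X]big1 => [|i /andP[_]].
  rewrite addr0 big_ord_narrow_cond; apply: eq_bigr => i _.
  have lt_iN : (widen_ord le_NM i < N)%N := ltn_ord i.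
  by rewrite (bar_pad_lt s lt_iN); congr (s _).2%:num; apply: val_inj.
by rewrite -leqNgt => /bar_pad_ge->.
Qed.

(** Reindexing along [pi] replaces the first n positions by the set of intervals placed there;
    padded intervals drop out because their length is 0. *)
Lemma sigma01_summandE (n N : nat) (s : bars R N) (pi : 'S_(maxn n N)) :
  \sum_(i < n) (bar_pad (maxn n N) s (pi (widen_ord (leq_maxl n N) i))).2%:num =
  \sum_(i < N | ((pi^-1)%g (widen_ord (leq_maxr n N) i) < n)%N) (s i).2%:num.
Proof.
rewrite -(sum_bar_pad s (leq_maxr n N) (fun i => ((pi^-1)%g i < n)%N)).
rewrite [RHS](reindex_inj (@perm_inj _ pi)) /=.
rewrite (eq_bigl (fun i : 'I_(maxn n N) => (i < n)%N)) => [|i];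
  last by rewrite permK.
rewrite big_ord_narrow ?leq_maxl // => le_n.
apply: eq_bigr => i _; congr (bar_pad _ _ (pi _)).2%:num; exact: val_inj.
Qed.

(** Sorting by membership in [A] puts [A] in the first [#|A|] positions, hence among the first n;
    the other intervals found there have nonnegative length and can only increase the sum. *)
Lemma sigma01_ge (n N : nat) (s : bars R N) (A : {set 'I_N}) :
  (#|A| <= n)%N -> \sum_(i in A) (s i).2%:num <= sigma01 n s.
Proof.
move=> le_An; set w := widen_ord (leq_maxr n N).
have inj_w : injective w by move=> i j /(congr1 val) /= eq_ij; apply: val_inj.
have [pi srt] := perm_sorting (fun i => i \in w @: A).
apply: le_trans (bigmax_ge _ _ pi).
rewrite sigma01_summandE; apply: sumr_subset_le => // i Ai.
pose D := (pi @^-1: (w @: A))%SET.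
have downD (j1 j2 : 'I_(maxn n N)) : (j1 <= j2)%N -> j2 \in D -> j1 \in D.
  by move=> /srt; rewrite !inE; do 2!case: (_ \in _).
have cardD : #|D| = #|A|.
  by rewrite card_preimset ?card_imset //; apply: perm_inj.
have := in_initial_segment downD ((pi^-1)%g (w i)).
rewrite inE permKV imset_f // cardD unfold_in /= => /esym/leq_trans; exact.
Qed.

Lemma sigma01_attained (n N : nat) (s : bars R N) :
  exists2 A : {set 'I_N}, (#|A| <= n)%N &
    sigma01 n s = \sum_(i in A) (s i).2%:num.
Proof.
pose F (pi : 'S_(maxn n N)) : R :=
  \sum_(i < n) (bar_pad (maxn n N) s (pi (widen_ord (leq_maxl n N) i))).2%:num.
have [pi sig] := bigmax_attained F 1%g.
set w := widen_ord (leq_maxr n N).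
(* The genuine intervals that an optimal [pi] puts in the first n positions. There may be fewer than
   n of them, as padding can fill some positions. *)
exists [set i | ((pi^-1)%g (w i) < n)%N]%SET; last first.
  by rewrite /sigma01 sig /F sigma01_summandE; apply: eq_bigl => i; rewrite inE.
have inj_w : injective (fun i => (pi^-1)%g (w i)).
  by move=> i j /perm_inj/(congr1 val) /= eq_ij; apply: val_inj.
rewrite -(card_imset _ inj_w); apply: leq_trans (card_ord_lt_le (maxn n N) n).
by apply/subset_leq_card/fintype.subsetP=> _ /imsetP[i + ->]; rewrite !inE.
Qed.

Lemma sigma01_0 (N : nat) (s : bars R N) : sigma01 0 s = 0.
Proof.
have [A] := sigma01_attained 0 s.
by rewrite leqn0 cards_eq0 => /eqP-> ->; rewrite big_set0.
Qed.

Lemma sigma01_perm (n N : nat) (s : bars R N) (pi : 'S_N) :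
  sigma01 n (fun i => s (pi i)) = sigma01 n s.
Proof.
apply/le_anti/andP; split.
  have [A le_An ->] := sigma01_attained n (fun i => s (pi i)).
  rewrite -(big_imset (fun i => (s i).2%:num) (in2W (@perm_inj _ pi))) /=.
  by apply: sigma01_ge; rewrite card_imset //; apply: perm_inj.
have [A le_An ->] := sigma01_attained n s.
have pi'_inj : injective (pi^-1)%g by apply: perm_inj.
apply: le_trans (sigma01_ge _ (A := ((pi^-1)%g @: A)%SET) _); last first.
  by rewrite card_imset.
rewrite (big_imset _ (in2W pi'_inj)) /=.
by apply: ler_sum => i _; rewrite permKV.
Qed.

Lemma sigma01_pad (n N M : nat) (s : bars R N) :
  (N <= M)%N -> sigma01 n (bar_pad M s) = sigma01 n s.
Proof.
move=> le_NM; set w := widen_ord le_NM.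
have inj_w : injective w by move=> i j /(congr1 val) /= eq_ij; apply: val_inj.
apply/le_anti/andP; split.
  have [A le_An ->] := sigma01_attained n (bar_pad M s).
  rewrite (sum_bar_pad s le_NM) -/w.
  rewrite (eq_bigl (fun i => i \in w @^-1: A)) => [|i]; last by rewrite inE.
  apply: sigma01_ge; apply: leq_trans le_An; rewrite -(card_imset _ inj_w).
  by apply/subset_leq_card/fintype.subsetP=> _ /imsetP[i + ->]; rewrite inE.
have [A le_An ->] := sigma01_attained n s.
apply: le_trans (sigma01_ge _ (A := w @: A) _); last by rewrite card_imset.
rewrite (sum_bar_pad s le_NM) -/w; apply: sumr_subset_le => // i.
by move=> Ai; rewrite unfold_in /=; apply: imset_f.
Qed.

(** Exchange argument with the threshold [th], the length at index n, the first one outside [I]. The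
    excess over [th] is nonnegative on [I] and nonpositive off [I], so no [A] has a larger total
    excess than [I]; the remaining [th *+ #|A|] is at most [th *+ n]. *)
Lemma sigma01_sorted (n N : nat) (s : bars R N) :
    (forall i j : 'I_N, (i <= j)%N -> (s j).2%:num <= (s i).2%:num) ->
  sigma01 n s = \sum_(i < N | (i < n)%N) (s i).2%:num.
Proof.
move=> srt; set I := [set i : 'I_N | (i < n)%N]%SET.
rewrite [RHS](eq_bigl [in I]) => [|i]; last by rewrite inE.
apply/le_anti/andP; split; last by apply: sigma01_ge; apply: card_ord_lt_le.
have [A le_An ->] := sigma01_attained n s.
have [le_Nn | lt_nN] := leqP N n.
  by apply: sumr_subset_le => // i _; rewrite inE (leq_trans (ltn_ord i)).
pose th := (s (Ordinal lt_nN)).2%:num.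
have geI i : i \in I -> th <= (s i).2%:num.
  by rewrite inE => /ltnW; apply: (srt i (Ordinal lt_nN)).
have leI i : i \notin I -> (s i).2%:num <= th.
  by rewrite inE -leqNgt; apply: (srt (Ordinal lt_nN)).
have split_th (B : {set 'I_N}) :
    \sum_(i in B) (s i).2%:num = \sum_(i in B) ((s i).2%:num - th) + th *+ #|B|.
  by rewrite sumrB sumr_const subrK.
rewrite !split_th (card_ord_lt (ltnW lt_nN)).
apply: lerD; last by apply: ler_wpMn2l; rewrite // /th.
rewrite (bigID [in I]) /= -[leRHS]addr0 lerD //; last first.
  by apply: sumr_le0 => i /andP[_ /leI]; rewrite subr_le0.
rewrite [leRHS](bigID [in A]) /= (eq_bigl _ _ (fun i => andbC _ _)) lerDl.
by apply: sumr_ge0 => i /andP[/geI]; rewrite subr_ge0.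
Qed.

End Sigma.

(** * Closure properties of the filtration [Dlim] and membership of [sigma01] *)

Section Family.
Variable R : realType.

(** A single expression built from the monomials witnesses both that [p] is a polynomial and that
    its degree is at most k. *)
Lemma kDS_intro (k n : nat) (p : bars R n -> R) (J : finType) (j0 : J)
    (a : J -> R) (c : J -> 'I_n + 'I_n -> nat) :
    (forall j, (\sum_v c j v <= k)%N) ->
    (forall s j, a j + \sum_v bar_coord s v *+ c j v <= p s) ->
    (forall s, exists j, p s = a j + \sum_v bar_coord s v *+ c j v) ->
    (forall (j : 'I_n) (s t : bars R n),
      (s j).2%:num = 0 -> (t j).2%:num = 0 ->
      (forall i, i != j -> s i = t i) -> p s = p t) ->
    symmetric_fun p ->
  kDS k p.
Proof.
move=> c_le ub_p p_att p_ind p_sym.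
have [e deg_e e_eq] := mp_exprP j0 a c_le.
have rep_e : represents e p by move=> s; apply: e_eq.
by split; [split=> //; split=> //; exists e | exists e].
Qed.

Lemma Dlim_mono (k l : nat) (f : bar_family R) :
  (k <= l)%N -> Dlim k f -> Dlim l f.
Proof.
move=> le_kl [fD f_compat]; split=> // n; have [? [e rep_e deg_e]] := fD n.
by split=> //; exists e => //; apply: leq_trans le_kl.
Qed.

Lemma Dlim_boxplus (k : nat) (f g : bar_family R) :
  Dlim k f -> Dlim k g -> Dlim k (boxplus f g).
Proof.
move=> [fD f_compat] [gD g_compat]; split; last first.
  by move=> n s; rewrite /boxplus f_compat g_compat.
move=> n; have [[[_ f_ind] f_sym] [e rep_e deg_e]] := fD n.
have [[[_ g_ind] g_sym] [e' rep_e' deg_e']] := gD n.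
pose a (j : 'I_(mp_size e).+1 + 'I_(mp_size e').+1) :=
  match j with inl i => mp_coef i | inr i => mp_coef i end.
pose c (j : 'I_(mp_size e).+1 + 'I_(mp_size e').+1) :=
  match j with inl i => mp_exp i | inr i => mp_exp i end.
apply: (@kDS_intro _ _ _ _ (inl ord0) a c).
- by case=> i; apply: mp_exp_le.
- move=> s [i|i]; rewrite /boxplus le_max rep_e rep_e'.
    by rewrite (mp_eval_ge (bar_coord s) i).
  by rewrite (mp_eval_ge (bar_coord s) i) orbT.
- move=> s; rewrite /boxplus.
  case: (leP (f n s) (g n s)) => _.
    by rewrite rep_e'; have [i ->] := mp_eval_attained e' (bar_coord s);
      exists (inr i).
  by rewrite rep_e; have [i ->] := mp_eval_attained e (bar_coord s);
    exists (inl i).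
- by move=> j s t s0 t0 st; rewrite /boxplus (f_ind j s t) // (g_ind j s t).
- by move=> pi s; rewrite /boxplus f_sym g_sym.
Qed.

Lemma Dlim_odot (k l : nat) (f g : bar_family R) :
  Dlim k f -> Dlim l g -> Dlim (k + l)%N (odot f g).
Proof.
move=> [fD f_compat] [gD g_compat]; split; last first.
  by move=> n s; rewrite /odot f_compat g_compat.
move=> n; have [[[_ f_ind] f_sym] [e rep_e deg_e]] := fD n.
have [[[_ g_ind] g_sym] [e' rep_e' deg_e']] := gD n.
(* By distributivity, a sum of two maxima is the maximum over pairs of monomials. *)
pose a (j : 'I_(mp_size e).+1 * 'I_(mp_size e').+1) :=
  mp_coef j.1 + mp_coef j.2.
pose c (j : 'I_(mp_size e).+1 * 'I_(mp_size e').+1) v :=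
  (mp_exp j.1 v + mp_exp j.2 v)%N.
have mono_split s j : a j + \sum_v bar_coord s v *+ c j v =
    mp_monomial e (bar_coord s) j.1 + mp_monomial e' (bar_coord s) j.2.
  rewrite /mp_monomial addrACA -big_split /=; congr (_ + _).
  by apply: eq_bigr => v _; rewrite mulrnDr.
apply: (@kDS_intro _ _ _ _ (ord0, ord0) a c).
- by move=> j; rewrite big_split leq_add ?mp_exp_le.
- by move=> s j; rewrite mono_split /odot rep_e rep_e' lerD ?mp_eval_ge.
- move=> s; rewrite /odot rep_e rep_e'.
  have [i ->] := mp_eval_attained e (bar_coord s).
  have [i' ->] := mp_eval_attained e' (bar_coord s).
  by exists (i, i'); rewrite mono_split.
- by move=> j s t s0 t0 st; rewrite /odot (f_ind j s t) // (g_ind j s t).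
- by move=> pi s; rewrite /odot f_sym g_sym.
Qed.

Lemma Dlim_const (x : R) : Dlim 0 (fun (n : nat) (s : bars R n) => x).
Proof.
split=> // n; apply: (@kDS_intro _ _ _ _ tt (fun=> x) (fun _ _ => 0%N)) => //.
- by move=> _; rewrite big1.
- by move=> s _; rewrite big1 ?addr0.
- by move=> s; exists tt; rewrite big1 ?addr0.
Qed.

Lemma sigma01_le (n N : nat) (s t : bars R N) :
  (forall i, (s i).2%:num <= (t i).2%:num) -> sigma01 n s <= sigma01 n t.
Proof.
move=> le_st; have [A le_An ->] := sigma01_attained n s.
by apply: le_trans (sigma01_ge _ le_An); apply: ler_sum.
Qed.

(** There is one monomial for each set of at most n indices, with exponent 1 on the lengths in the
    set and 0 on all other variables, so the degree is at most n. *)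
Lemma Dlim_sigma01 (n : nat) : Dlim n (@sigma01 R n).
Proof.
split; last by move=> N s; apply: sigma01_pad.
move=> N; pose J := {A : {set 'I_N} | (#|A| <= n)%N}.
have le_0n : (#|@finset.set0 'I_N| <= n)%N by rewrite cards0.
pose c (A : J) (v : 'I_N + 'I_N) : nat :=
  if v is inr i then i \in val A else 0%N.
have mono_sum s A :
    0 + \sum_v bar_coord s v *+ c A v = \sum_(i in val A) (s i).2%:num.
  rewrite add0r big_sumType /= big1 ?add0r // [RHS]big_mkcond /=.
  by apply: eq_bigr => i _; case: (i \in _).
apply: (@kDS_intro _ _ _ _ (Sub finset.set0 le_0n : J) (fun=> 0) c).
- move=> [A le_An]; rewrite big_sumType /= big1 // add0n.
  by rewrite -big_mkcond sum1_card.
- by move=> s [A le_An]; rewrite mono_sum; apply: sigma01_ge.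
- move=> s; have [A le_An ->] := sigma01_attained n s.
  by exists (Sub A le_An); rewrite mono_sum.
- move=> j s t s0 t0 st.
  have st2 i : (s i).2%:num = (t i).2%:num.
    by case: (eqVneq i j) => [->|/st->//]; rewrite s0 t0.
  by apply/le_anti/andP; split; apply: sigma01_le => i; rewrite st2.
- by move=> pi s; apply: sigma01_perm.
Qed.

Lemma Dlim_pad (k n N : nat) (f : bar_family R) (s : bars R n) :
  Dlim k f -> (n <= N)%N -> f N (bar_pad N s) = f n s.
Proof.
move=> [_ f_compat]; elim: N => [|N IHN].
  by rewrite leqn0 => /eqP n0; subst n; rewrite bar_pad_id.
rewrite leq_eqVlt => /orP[/eqP n_eq|le_nN].
  by subst n; rewrite bar_pad_id.
rewrite -(@bar_pad_pad _ n N) ?f_compat ?IHN //.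
by rewrite geq_min -ltnS le_nN.
Qed.

(** * Absence of left endpoints from the expressions of elements of [Dn] *)

Lemma Dn_zero_len (n : nat) (p : bars R n -> R) (s t : bars R n) : Dn p ->
    (forall i, (s i).2%:num = 0) -> (forall i, (t i).2%:num = 0) ->
  p s = p t.
Proof.
move=> [_ p_ind] s0 t0.
(* The hybrids [h m] turn [s] into [t] one interval at a time, each change being allowed by the
   defining condition of [Dn]. *)
pose h m : bars R n := fun i => if (i < m)%N then t i else s i.
have h0 m i : (h m i).2%:num = 0 by rewrite /h; case: ifP.
have ph m : (m <= n)%N -> p s = p (h m).
  elim: m => [_|m IHm lt_mn]; first by congr p; apply: funext.
  rewrite IHm ?(ltnW lt_mn) //; apply: (p_ind (Ordinal lt_mn)) => // i ne_im.
  by rewrite /h ltnS [(i <= m)%N]leq_eqVlt (negbTE (ne_im : (i : nat) != m)).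
by rewrite (ph n) //; congr p; apply: funext => i; rewrite /h ltn_ord.
Qed.

(* With all lengths 0 the function is constant, whereas a monomial containing
   some x_j would grow without bound along x_1 = ... = x_n = t. *)
Lemma Dn_exp_inl (n : nat) (p : bars R n -> R) e (i : 'I_(mp_size e).+1) j :
  Dn p -> represents e p -> mp_exp i (inl j) = 0%N.
Proof.
move=> Dp rep_e; case exp_j: (mp_exp _ _) => [//|m].
pose o : {nonneg R} := NngNum (lexx 0); pose s x : bars R n := fun=> (x, o).
(* Chosen larger than [p (s o) - mp_coef i], which would bound the variable part of the monomial. *)
pose x0 : {nonneg R} :=
  NngNum (addr_ge0 (normr_ge0 (p (s o) - mp_coef i)) ler01).
have: mp_monomial e (bar_coord (s x0)) i <= p (s o).
  by rewrite (Dn_zero_len (t := s x0) Dp) // rep_e mp_eval_ge.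
have: x0%:num <= \sum_v bar_coord (s x0) v *+ mp_exp i v.
  rewrite (bigD1 (inl j)) //= exp_j mulrS -addrA lerDl addr_ge0 ?mulrn_wge0 //.
  by apply: sumr_ge0 => -[v|v] _; rewrite mulrn_wge0 //=.
move=> x0_le; rewrite /mp_monomial -lerBrDl => /(le_trans x0_le).
by rewrite leNgt; case/negP; rewrite (le_lt_trans (ler_norm _)) ?ltrDl.
Qed.

(** * Level sets of exponents and expressions in the [sigma01] *)

Lemma mulrn_sum_lt (x : R) (m k : nat) : (m <= k)%N ->
  x *+ m = \sum_(t < k | (t < m)%N) x.
Proof. by move=> le_mk; rewrite big_ord_narrow // sumr_const card_ord. Qed.

(** Each [c i] counts the levels [t < k] with [t < c i]; exchanging the two sums groups the terms by
    level. *)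
Lemma sum_level_sets (k n : nat) (d : 'I_n -> R) (c : 'I_n -> nat) :
    (forall i, (c i <= k)%N) ->
  \sum_i d i *+ c i = \sum_(t < k) \sum_(i in [set i | (t < c i)%N]%SET) d i.
Proof.
move=> c_le; rewrite (eq_bigr (fun i => \sum_(t < k | (t < c i)%N) d i)).
  rewrite (exchange_big_dep xpredT) //=; apply: eq_bigr => t _.
  by apply: eq_bigl => i; rewrite inE.
by move=> i _; apply: mulrn_sum_lt.
Qed.

(** Collects equal factors into powers. Values [h t = 0] are absent on the left, which is harmless
    because [sigma01 0] vanishes. *)
Lemma sum_sigma01 (k N : nat) (s : bars R N) (h : 'I_k -> nat) :
    (forall t, (h t <= k)%N) ->
  \sum_(j < k) sigma01 j.+1 s *+ #|[set t | h t == j.+1]%SET| =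
  \sum_(t < k) sigma01 (h t) s.
Proof.
move=> h_le.
rewrite (eq_bigr (fun j : 'I_k => \sum_(t | h t == j.+1) sigma01 j.+1 s));
  last first.
  by move=> j _; rewrite -sumr_const; apply: eq_bigl => t; rewrite inE.
rewrite (exchange_big_dep xpredT) //=; apply: eq_bigr => t _.
case ht: (h t) => [|m]; first by rewrite sigma01_0 big1.
have lt_mk : (m < k)%N by rewrite -ht.
by rewrite (big_pred1 (Ordinal lt_mk)) // => j; rewrite eqSS eq_sym.
Qed.

(** The preimage of [L] under [tau] is an initial segment with [#|L|] elements, and on sorted
    lengths such a segment carries the longest intervals. *)
Lemma perm_sum_initial (N : nat) (s : bars R N) (tau : 'S_N) (L : {set 'I_N}) :
    (forall i j : 'I_N, (i <= j)%N -> (s j).2%:num <= (s i).2%:num) ->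
    (forall i j : 'I_N, (i <= j)%N -> tau j \in L -> tau i \in L) ->
  \sum_(i in L) (s ((tau^-1)%g i)).2%:num = sigma01 #|L| s.
Proof.
move=> srt downL; rewrite sigma01_sorted //.
rewrite (reindex_inj (@perm_inj _ tau)) /=.
rewrite (eq_bigr (fun i => (s i).2%:num)) => [|i _]; last by rewrite permK.
apply: eq_bigl => i.
have := @in_initial_segment _ (tau @^-1: L)%SET _ i.
rewrite inE card_preimset; last exact: perm_inj.
by apply=> j1 j2; rewrite !inE; apply: downL.
Qed.

Lemma perm_bars_sorted (N : nat) (s : bars R N) :
  exists pi : 'S_N, forall i j : 'I_N, (i <= j)%N ->
    (s (pi j)).2%:num <= (s (pi i)).2%:num.
Proof. exact: (perm_sorting (fun i => (s i).2%:num)). Qed.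

(* The level sets {i | t < c i} are nested, so one permutation maximizes the
   sums over all of them simultaneously. *)
Lemma kDS_sigma01 (k N : nat) (f : bars R N -> R) : kDS k f ->
  exists P : mp_expr R 'I_k,
    forall s, f s = mp_eval P (fun j => sigma01 j.+1 s).
Proof.
move=> [[Df f_sym] [e rep_e deg_e]].
pose c (i : 'I_(mp_size e).+1) (j : 'I_N) := mp_exp i (inr j).
have f_mono s i :
    mp_monomial e (bar_coord s) i = mp_coef i + \sum_j (s j).2%:num *+ c i j.
  congr (_ + _); rewrite big_sumType /= big1 ?add0r // => j _.
  by rewrite (Dn_exp_inl _ _ Df rep_e).
have sum_c_le i : (\sum_j c i j <= k)%N.
  by apply: leq_trans (mp_exp_le i deg_e); rewrite big_sumType /= leq_addl.
have c_le i j : (c i j <= k)%N.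
  by apply: leq_trans (sum_c_le i); rewrite (bigD1 j) //= leq_addr.
pose L i t := [set j | (t < c i j)%N]%SET.
have card_L i t : (#|L i t| <= k)%N.
  apply: leq_trans (sum_c_le i); rewrite -sum1_card big_mkcond.
  rewrite leq_sum // => j _.
  by rewrite inE; case: ifP => // /(leq_ltn_trans _); apply.
(* The exponent of [sigma01 j.+1] in monomial [i] is the number of levels whose level set has [j.+1]
   elements. *)
pose P := MPExpr (@mp_coef R _ e)
  (fun i (j : 'I_k) => #|[set t : 'I_k | #|L i t| == j.+1]%SET|).
have P_mono s i : mp_monomial P (fun j => sigma01 j.+1 s) i =
    mp_coef i + \sum_(t < k) sigma01 #|L i t| s.
  by rewrite /mp_monomial /= sum_sigma01.
exists P => s.
wlog srt: s / forall i j : 'I_N, (i <= j)%N -> (s j).2%:num <= (s i).2%:num.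
  move=> IH; have [pi srt] := perm_bars_sorted s; rewrite -(f_sym pi) IH //.
  by congr mp_eval; apply: funext => j; apply: sigma01_perm.
apply/le_anti/andP; split.
  rewrite rep_e; have [i ->] := mp_eval_attained e (bar_coord s).
  apply: le_trans (mp_eval_ge (e := P) _ i).
  rewrite f_mono P_mono lerD2l (sum_level_sets _ (c_le i)).
  by apply: ler_sum => t _; apply: sigma01_ge.
have [i ->] := mp_eval_attained P (fun j => sigma01 j.+1 s).
(* Listing the indices by decreasing exponent makes every level set initial. Permuting [s] by the
   inverse of [tau] then gives the largest exponents to the longest intervals. *)
have [tau c_srt] := perm_sorting (c i).
rewrite -(f_sym (tau^-1)%g) rep_e.
apply: le_trans (mp_eval_ge (e := e) _ i).
rewrite f_mono P_mono lerD2l (sum_level_sets _ (c_le i)).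
apply: ler_sum => t _; rewrite perm_sum_initial // => j1 j2 /c_srt le_c.
by rewrite !inE => /leq_trans; apply.
Qed.

(** On sorted lengths only the first j intervals count, and replacing those from index k on by zeros
    keeps the lengths sorted. *)
Lemma sigma01_truncate (j k N : nat) (s : bars R N) :
    (forall i1 i2 : 'I_N, (i1 <= i2)%N -> (s i2).2%:num <= (s i1).2%:num) ->
    (j <= k)%N ->
  sigma01 j (bar_pad N (bar_pad k s)) = sigma01 j s.
Proof.
move=> srt le_jk; set s' := bar_pad N _.
have s'E i : (s' i).2%:num = if (i < k)%N then (s i).2%:num else 0.
  case: (ltnP i k) => [lt_ik | le_ki]; last by rewrite /s' bar_pad_ge.
  rewrite /s' (bar_pad_lt _ lt_ik).
  rewrite (@bar_pad_lt _ _ _ _ (Ordinal lt_ik) (ltn_ord i)).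
  by congr (s _).2%:num; apply: val_inj.
rewrite !sigma01_sorted //; last first.
  move=> i1 i2 le_i; rewrite !s'E.
  case: (ltnP i2 k) => [lt_i2|]; last by case: ifP.
  by rewrite (leq_ltn_trans le_i lt_i2) srt.
by apply: eq_bigr => i lt_ij; rewrite s'E (leq_trans lt_ij).
Qed.

Lemma Dlim_sigma01_generated (k : nat) (f : bar_family R) : Dlim k f ->
  exists P : mp_expr R 'I_k, forall N (s : bars R N),
    f N s = mp_eval P (fun j => sigma01 j.+1 s).
Proof.
move=> fD; have [P fk_eq] := kDS_sigma01 (fD.1 k); exists P => N s.
have [le_Nk | /ltnW le_kN] := leqP N k.
  rewrite -(Dlim_pad s fD le_Nk) fk_eq.
  by congr mp_eval; apply: funext => j; apply: sigma01_pad.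
wlog srt: s / forall i j : 'I_N, (i <= j)%N -> (s j).2%:num <= (s i).2%:num.
  move=> IH; have [pi srt] := perm_bars_sorted s.
  rewrite -((fD.1 N).1.2 pi) IH //.
  by congr mp_eval; apply: funext => j; apply: sigma01_perm.
(* [Q] shows that [f N] factors through the first k functions [sigma01], so truncating [s] to k
   intervals preserves its value; compatibility then passes from [f N] to [f k]. *)
have [Q fN_eq] := kDS_sigma01 (fD.1 N).
have sigma_trunc : (fun j : 'I_k => sigma01 j.+1 s) =
    (fun j => sigma01 j.+1 (bar_pad N (bar_pad k s))).
  by apply: funext => j; rewrite sigma01_truncate.
rewrite fN_eq sigma_trunc -fN_eq (Dlim_pad _ fD le_kN) fk_eq.
by congr mp_eval; apply: funext => j; rewrite [RHS]sigma01_pad.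
Qed.

End Family.

(** * Semiring laws, filtration and generation *)

Local Open Scope classical_set_scope.

Theorem theorem4p5 (R : realType) :
  is_filtered_semiring (@Dbar R) (@boxplus R) (@odot R) (@Dlim R) /\
  (forall n : nat, (0 < n)%N -> @Dbar R (@sigma01 R n)) /\
  (forall f : bar_family R, @Dbar R f ->
     exists (r : nat) (ns : 'I_r -> nat) (P : mp_expr R 'I_r),
       (forall i : 'I_r, (0 < ns i)%N) /\
       f = (fun (N : nat) (s : bars R N) =>
              mp_eval P (fun i : 'I_r => @sigma01 R (ns i) N s))).
Proof.
have ext (f g : bar_family R) : (forall n s, f n s = g n s) -> f = g.
  by move=> fg; apply: functional_extensionality_dep => n; apply: funext.
(* The union defining [Dbar] starts at degree 1 and the filtration at degree 0; monotonicity
   reconciles them. *)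
have DbarE : @Dbar R = \bigcup_k @Dlim R k.
  apply/seteqP; split=> f [k _ fD]; first by exists k => //.
  by exists k.+1 => //; apply: Dlim_mono fD.
split; last split; last 1 first.
- move=> f [k _ /Dlim_sigma01_generated[P fE]].
  by exists k, (fun i : 'I_k => i.+1), P; split=> //; apply: ext.
- split=> //; last first.
  + exact: Dlim_odot.
  + by move=> d d' le_dd' f; apply: Dlim_mono.
  + exact: Dlim_boxplus.
  split.
  + rewrite DbarE => f g [k _ fD] [l _ gD]; exists (maxn k l) => //.
    by apply: Dlim_boxplus; [apply: Dlim_mono fD | apply: Dlim_mono gD];
      rewrite ?leq_maxl ?leq_maxr.
  + rewrite DbarE => f g [k _ fD] [l _ gD]; exists (k + l)%N => //.
    exact: Dlim_odot.
  + by move=> f g h _ _ _; apply: ext => n s; apply: maxA.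
  + by move=> f g _ _; apply: ext => n s; apply: maxC.
  + by move=> f g h _ _ _; apply: ext => n s; apply: addrA.
  + exists (fun _ _ => 0).
      by rewrite DbarE; exists 0%N => //; apply: Dlim_const.
    by move=> f _; split; apply: ext => n s; rewrite /odot ?add0r ?addr0.
  + by move=> f g h _ _ _; apply: ext => n s; apply: addr_maxl.
  + by move=> f g h _ _ _; apply: ext => n s; apply: addr_maxr.
- by move=> n n_gt0; exists n => //; apply: Dlim_sigma01.
Qed.
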